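(* $\lambda_{2,3}(3)=21$, $\lambda_{2,5}(3)=19$, $\lambda_{2,9}(3)=19$, $\lambda_{2,11}(3)=23$, $\lambda_{2,13}(3)=22$, $\lambda_{2,15}(3)=21$, $\lambda_{2,19}(3)=22$, and $\lambda_{2,21}(3)=26$.
   Context: For an odd integer $n>1$, a representation of a positive integer $k$ (with respect to $2$ and $n$) is an expression $k=\sum_{j\ge 0}\varepsilon_j(2)2^j+\sum_{j\ge 0}\varepsilon_j(n)n^j$ with only finitely many nonzero coefficients, where $\varepsilon_j(2)\in\{0,\pm1\}$ and $\varepsilon_j(n)\in\{0,\pm1,\dots,\pm\lfloor n/2\rfloor\}$ are integers. Its length is $\sum_{j\ge 0}(|\varepsilon_j(2)|+|\varepsilon_j(n)|)$. For a positive integer $h$, $\lambda_{2,n}(h)$ denotes the smallest positive integer that has a representation of length $h$ but no representation of length less than $h$. *)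

(* Defs.v *)
From mathcomp Require Import all_boot all_order all_algebra.
From mathcomp Require Import finmap.

Set Implicit Arguments.
Unset Strict Implicit.
Unset Printing Implicit Defensive.

Import Order.TTheory GRing.Theory Num.Theory.
Local Open Scope ring_scope.

Definition digits := {fsfun nat -> int with 0}.

Definition digits_value (b : nat) (e : digits) : int :=
  \sum_(j <- finsupp e) e j * b%:Z ^+ j.

Definition digits_length (e : digits) : nat :=
  (\sum_(j <- finsupp e) `|e j|)%N.

(* [b./2] is the floor of b / 2; for b = 2 the bound is 1. *)
Definition digits_bounded (b : nat) (e : digits) : Prop :=
  forall j : nat, (`|e j| <= b./2)%N.

Definition representation (n k : nat) (e2 en : digits) : Prop :=
  [/\ digits_bounded 2 e2, digits_bounded n en
    & k%:Z = digits_value 2 e2 + digits_value n en].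

Definition has_representation (n k h : nat) : Prop :=
  exists e2 en : digits,
    representation n k e2 en /\ (digits_length e2 + digits_length en)%N = h.

Definition has_minimal_length (n h k : nat) : Prop :=
  has_representation n k h /\
  forall h' : nat, (h' < h)%N -> ~ has_representation n k h'.

(* lambda_{2,n}(h) = k, as a relation: no existence of a least integer is
   presupposed, and k is unique when it exists. *)
Definition is_lambda (n h k : nat) : Prop :=
  [/\ (0 < k)%N, has_minimal_length n h k
    & forall m : nat, (0 < m)%N -> has_minimal_length n h m -> (k <= m)%N].

(* Main.v *)
Require Import Defs.
From mathcomp Require Import all_boot all_order all_algebra.
From mathcomp Require Import finmap.

(** A representation of length less than 3 writes k as a sum of two elements of
    {0} U {+-2^j} U {+-n^j}. For each pair (n, k) there is a small modulus M for
    which k is not congruent to any such sum; this is a finite check because the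
    powers of 2 and of n are eventually periodic modulo M. Every m < k
    is a sum of at most two admissible terms with exponents at most 5. *)

Set Implicit Arguments.
Unset Strict Implicit.
Unset Printing Implicit Defensive.

Import Order.TTheory GRing.Theory Num.Theory.
Local Open Scope ring_scope.

Definition signed_power (b : nat) (x : int) : Prop :=
  exists (s : bool) (j : nat), x = (-1) ^+ s * b%:Z ^+ j.

(** Each digit [f j] splits into [|f j|] equal terms carrying its sign, so length becomes the number
    of terms. *)
Lemma sum_signed_powers (b : nat) (f : nat -> int) (r : seq nat) :
  exists t : seq int,
    [/\ size t = (\sum_(j <- r) `|f j|)%N,
        \sum_(x <- t) x = \sum_(j <- r) f j * b%:Z ^+ j
      & {in t, forall x, signed_power b x}].
Proof.
elim: r => [|j r [t [size_t sum_t pow_t]]].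
  by exists [::]; rewrite !big_nil.
exists (nseq `|f j| ((-1) ^+ (f j < 0)%R * b%:Z ^+ j) ++ t); split.
- by rewrite size_cat size_nseq big_cons size_t.
- rewrite big_cat big_cons /= sum_t big_nseq iter_addr_0; congr (_ + _).
  by rewrite [in RHS](intEsign (f j)) -mulr_natr natz mulrAC.
- move=> x; rewrite mem_cat => /orP[/nseqP[-> _]|/pow_t//].
  by exists (f j < 0), j.
Qed.

(** Padding with 0 turns lengths 0, 1 and 2 into a single case with exactly two terms. *)
Lemma short_representation_two_terms (n k h : nat) :
  has_representation n k h -> (h < 3)%N ->
  exists x y : int,
    [/\ k%:Z = x + y, [\/ x = 0, signed_power 2 x | signed_power n x]
      & [\/ y = 0, signed_power 2 y | signed_power n y]].
Proof.
move=> [e2 [en [[_ _ k_sum] <-]]] len_lt3.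
have [t2 [size2 sum2 pow2]] := sum_signed_powers 2 e2 (finsupp e2).
have [tn [sizen sumn pown]] := sum_signed_powers n en (finsupp en).
have {k_sum} : k%:Z = \sum_(x <- t2 ++ tn) x by rewrite big_cat /= sum2 sumn.
have : (size (t2 ++ tn) < 3)%N by rewrite size_cat size2 sizen.
have : {in t2 ++ tn, forall x, [\/ x = 0, signed_power 2 x | signed_power n x]}.
  move=> x; rewrite mem_cat => /orP[/pow2|/pown].
    by constructor 2.
  by constructor 3.
case: (t2 ++ tn) => [|x [|y [|//]]] pow _; rewrite ?big_cons big_nil.
- by move=> ->; exists 0, 0; split=> //; constructor 1.
- by move=> ->; exists x, 0; split=> //; [apply: pow; rewrite inE | constructor 1].
- by rewrite addr0 => ->; exists x, y; split=> //; apply: pow; rewrite !inE eqxx ?orbT.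
Qed.

(** The orbit of 1 under multiplication by [b], with its negatives. It captures every signed power
    once [N] reaches preperiod plus period, which [looping] tests. *)
Definition power_residues (M : int) (b N : nat) : seq int :=
  let r := traject (fun x => (x * b%:Z %% M)%Z) (1 %% M)%Z N in
  r ++ [seq (- x %% M)%Z | x <- r].

Lemma signed_power_residue (M : int) (b N : nat) (x : int) :
  looping (fun x => (x * b%:Z %% M)%Z) (1 %% M)%Z N ->
  signed_power b x -> (x %% M)%Z \in power_residues M b N.
Proof.
move=> /loopingP loop [s [j ->]].
have pow_mod : (b%:Z ^+ j %% M)%Z = iter j (fun x => (x * b%:Z %% M)%Z) (1 %% M)%Z.
  by elim: j => [|j IHj] //; rewrite iterS -IHj modzMml exprSr.
rewrite mem_cat; case: s; last by rewrite mul1r pow_mod loop.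
rewrite expr1 mulN1r -modzNm pow_mod; apply/orP; right.
exact: (map_f (fun x => (- x %% M)%Z)).
Qed.

Definition two_term_obstruction (M : int) (n k N : nat) : bool :=
  let U := (0 %% M)%Z :: power_residues M 2 N ++ power_residues M n N in
  [&& looping (fun x => (x * 2 %% M)%Z) (1 %% M)%Z N,
      looping (fun x => (x * n%:Z %% M)%Z) (1 %% M)%Z N
    & all (fun u => all (fun v => ((u + v) %% M)%Z != (k%:Z %% M)%Z) U) U].

Lemma two_term_obstructionP (M : int) (n k N h : nat) :
  two_term_obstruction M n k N -> (h < 3)%N -> ~ has_representation n k h.
Proof.
case/and3P=> loop2 loopn /allP no_sum h_lt3 rep.
have [x [y [k_sum x_term y_term]]] := short_representation_two_terms rep h_lt3.
have residue z : [\/ z = 0, signed_power 2 z | signed_power n z] ->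
    (z %% M)%Z \in (0 %% M)%Z :: power_residues M 2 N ++ power_residues M n N.
  rewrite inE mem_cat => -[->|pow|pow]; first by rewrite eqxx.
    by rewrite (signed_power_residue loop2 pow) orbT.
  by rewrite (signed_power_residue loopn pow) !orbT.
have /allP/(_ _ (residue y y_term)) := no_sum _ (residue x x_term).
by rewrite modzDm -k_sum eqxx.
Qed.

Definition digits_of_seq (s : seq int) : digits :=
  [fsfun j in [fset i in iota 0 (size s)]%fset => s`_j].

Lemma digits_of_seqE (s : seq int) (j : nat) : digits_of_seq s j = s`_j.
Proof.
rewrite fsfunE !inE mem_iota /=; case: ltnP => // le_size_j.
by rewrite nth_default.
Qed.

(** The support omits the zero entries of [s]; these contribute only the neutral element. *)
Lemma big_digits_of_seq (R : Type) (idx : R) (op : Monoid.com_law idx)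
    (s : seq int) (F : nat -> int -> R) :
  (forall j, F j 0 = idx) ->
  \big[op/idx]_(j <- finsupp (digits_of_seq s)) F j (digits_of_seq s j) =
  \big[op/idx]_(0 <= j < size s) F j s`_j.
Proof.
move=> F0; under eq_bigr do rewrite digits_of_seqE.
rewrite (@big_fset_incl _ _ _ _ _ [fset i in iota 0 (size s)]%fset).
- rewrite /index_iota subn0; apply: perm_big.
  apply: uniq_perm; rewrite ?iota_uniq ?fset_uniq //.
  by move=> j; rewrite !inE.
- exact: finsupp_sub.
- by move=> j _; rewrite memNfinsupp digits_of_seqE => /eqP->.
Qed.

Lemma digits_of_seq_value (b : nat) (s : seq int) :
  digits_value b (digits_of_seq s) = horner_rec s b%:Z.
Proof.
rewrite /digits_value (@big_digits_of_seq _ _ _ _ (fun j c => c * b%:Z ^+ j)).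
  (* [Poly s] drops trailing zeros, so its size is only bounded by [size s]; the wide form of the
     coefficient sum absorbs the difference. *)
  rewrite -horner_Poly (horner_coef_wide _ (size_Poly s)) big_mkord.
  by apply: eq_bigr => j _; rewrite coef_Poly.
by move=> j; rewrite mul0r.
Qed.

Lemma digits_of_seq_length (s : seq int) :
  digits_length (digits_of_seq s) = sumn (map absz s).
Proof.
rewrite /digits_length (@big_digits_of_seq _ _ _ _ (fun _ c => `|c|%N)) //.
by rewrite sumnE big_map [RHS](big_nth 0).
Qed.

Lemma digits_of_seq_bounded (b : nat) (s : seq int) :
  all (fun c : int => (`|c| <= b./2)%N) s -> digits_bounded b (digits_of_seq s).
Proof.
move=> /allP s_le j; rewrite digits_of_seqE.
have [lt_j|le_j] := ltnP j (size s); first exact/s_le/mem_nth.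
by rewrite nth_default.
Qed.

(** A search space for witnesses, lowest digit first: [d] is the number of digits and [w] the length
    still available, which prunes the search. *)
Fixpoint digit_seqs (d w : nat) : seq (seq int) :=
  if d is d'.+1 then
    flatten [seq [seq c :: s | s <- digit_seqs d' (w - `|c|)]
            | c : int <- [:: 0; 1; -1; 2; -2] & (`|c| <= w)%N]
  else [:: [::]].

(* Tests the length before the value, so that most candidates are discarded
   without evaluating a unary integer. *)
Definition representable (n k h : nat) : bool :=
  has (fun s2 => has (fun sn =>
    [&& (sumn (map absz s2) + sumn (map absz sn) == h)%N,
        all (fun c : int => (`|c| <= 2./2)%N) s2,
        all (fun c : int => (`|c| <= n./2)%N) sn
      & horner_rec s2 2 + horner_rec sn n%:Z == k%:Z])
    (digit_seqs 2 h)) (digit_seqs 6 h).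

Lemma representableP (n k h : nat) :
  representable n k h -> has_representation n k h.
Proof.
case/hasP=> s2 _ /hasP[sn _ /and4P[/eqP len le2 len_ /eqP val]].
exists (digits_of_seq s2), (digits_of_seq sn); split; last first.
  by rewrite !digits_of_seq_length.
split; [exact: digits_of_seq_bounded | exact: digits_of_seq_bounded |].
by rewrite !digits_of_seq_value val.
Qed.

(** The obstruction excludes lengths below 3 for [k]. Each positive [m < k] has length 1 or 2, which
    contradicts minimality of length 3. *)
Lemma is_lambda3_certificate (n k N : nat) (M : int) :
  (0 < k)%N -> two_term_obstruction M n k N -> representable n k 3 ->
  all (fun m => representable n m 1 || representable n m 2) (iota 1 k.-1) ->
  is_lambda n 3 k.
Proof.
move=> k_gt0 obstr rep_k /allP short; split=> //.
  split; first exact: representableP.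
  by move=> h'; exact: two_term_obstructionP obstr.
move=> m m_gt0 [_ m_min]; rewrite leqNgt; apply/negP => m_lt.
have /short/orP[] : m \in iota 1 k.-1 by rewrite mem_iota m_gt0 add1n prednK.
  by move/representableP; exact: m_min.
by move/representableP; exact: m_min.
Qed.

Theorem theorem2 :
  is_lambda 3 3 21 /\ is_lambda 5 3 19 /\ is_lambda 9 3 19 /\
  is_lambda 11 3 23 /\ is_lambda 13 3 22 /\ is_lambda 15 3 21 /\
  is_lambda 19 3 22 /\ is_lambda 21 3 26.
Proof.
(* Each modulus leaves few residues of powers: modulo 72 the powers of 2 take nine values, and those
   of 3 only 1, 3, 9, 27. *)
split; first by apply: (@is_lambda3_certificate _ _ 12 72); vm_compute.
split; first by apply: (@is_lambda3_certificate _ _ 12 62); vm_compute.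
split; first by apply: (@is_lambda3_certificate _ _ 12 40); vm_compute.
split; first by apply: (@is_lambda3_certificate _ _ 12 60); vm_compute.
(* Since 2 has order 12 modulo 65, its powers modulo 130 have preperiod 1 and period 12, hence the
   bound 13. *)
split; first by apply: (@is_lambda3_certificate _ _ 13 130); vm_compute.
split; first by apply: (@is_lambda3_certificate _ _ 12 48); vm_compute.
split; first by apply: (@is_lambda3_certificate _ _ 12 72); vm_compute.
by apply: (@is_lambda3_certificate _ _ 12 126); vm_compute.
Qed.
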